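(* Let $C$ be a repeated coloring of $\mathbb{Z}^d$, where $d=nk$. Then \[ d \le s^R(C)\cdot\bigl(2s^B(C)-1\bigr). \]
   Context: A two-coloring of $\mathbb{Z}^m$ assigns to each lattice point the color red or blue. It is non-trivial if the origin is red and, for each $i\in\{1,\dots,m\}$, there is at least one blue point on the $i$-th coordinate axis. For a point $x$, the axis-sensitivity $r(C,x)$ is the number of coordinate directions $i$ such that $x+e_i$ or $x-e_i$ is colored differently from $x$. The red sensitivity $s^R(C)$ is the maximum of $r(C,x)$ over red points $x$, and the blue sensitivity $s^B(C)$ is the maximum of $r(C,x)$ over blue points $x$. Index the $nk$ coordinates of $\mathbb{Z}^{nk}$ by pairs $\{i,j\}$ with $1\le i\le n$ and $1\le j\le k$. For $x\in\mathbb{Z}^{nk}$, let $x_i\in\mathbb{Z}^k$ be the $k$-tuple $(x_{\{i,1\}},\dots,x_{\{i,k\}})$. A two-coloring $C$ of $\mathbb{Z}^{nk}$ is a repeated coloring if there is a non-trivial two-coloring $C'$ of $\mathbb{Z}^k$ satisfying two conditions: (1) $s^R(C')=1$; (2) a point $x$ is blue in $C$ if and only if $x_i$ is blue in $C'$ for some $i\in\{1,\dots,n\}$. *)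

(* Defs.v *)
From mathcomp Require Import all_boot all_order all_algebra.
From mathcomp Require Import boolp.

Set Implicit Arguments.
Unset Strict Implicit.
Unset Printing Implicit Defensive.

Import Order.TTheory GRing.Theory Num.Theory.

Local Open Scope ring_scope.

(* Z^m, with coordinates indexed by an arbitrary finite type I with #|I| = m;
   this lets Z^(nk) be indexed directly by the pairs in 'I_n * 'I_k. *)
Definition lattice (I : finType) : Type := {ffun I -> int}.

(* The value true stands for blue and false for red. *)
Definition coloring (I : finType) : Type := lattice I -> bool.

Definition blue (I : finType) (C : coloring I) (x : lattice I) : bool := C x.
Definition red (I : finType) (C : coloring I) (x : lattice I) : bool := ~~ C x.

Definition unit_vec (I : finType) (i : I) : {ffun I -> int} :=
  [ffun j => if j == i then 1 else 0].

Definition on_axis (I : finType) (i : I) (x : lattice I) : Prop :=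
  forall j : I, j != i -> x j = 0.

Definition nontrivial (I : finType) (C : coloring I) : Prop :=
  red C (0 : {ffun I -> int}) /\
  forall i : I, exists x : lattice I, on_axis i x /\ blue C x.

Definition axis_sensitivity (I : finType) (C : coloring I)
    (x : {ffun I -> int}) : nat :=
  #|[set i : I | (C (x + unit_vec i) != C x) || (C (x - unit_vec i) != C x)]|.

(* Axis-sensitivities are at most #|I|, so the maximum may be taken over the
   finitely many values r <= #|I| attained at a point of P.  It is 0 when no
   point satisfies P. *)
Definition max_sensitivity (I : finType) (C : coloring I)
    (P : lattice I -> bool) : nat :=
  \max_(r < #|I|.+1 | `[< exists x, P x /\ axis_sensitivity C x = r >]) r.

Definition red_sensitivity (I : finType) (C : coloring I) : nat :=
  max_sensitivity C (red C).

Definition blue_sensitivity (I : finType) (C : coloring I) : nat :=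
  max_sensitivity C (blue C).

Lemma max_sensitivity_ge (I : finType) (C : coloring I)
    (P : lattice I -> bool) (x : lattice I) :
  P x -> (axis_sensitivity C x <= max_sensitivity C P)%N.
Proof.
move=> Px.
have lt_r : (axis_sensitivity C x < #|I|.+1)%N by rewrite ltnS max_card.
apply: (bigop.bigmax_sup (Ordinal lt_r)) => //.
by apply/asboolP; exists x.
Qed.

Lemma max_sensitivity_attained (I : finType) (C : coloring I)
    (P : lattice I -> bool) (x0 : lattice I) :
  P x0 -> exists x, P x /\ axis_sensitivity C x = max_sensitivity C P.
Proof.
move=> Px0.
have lt_r : (axis_sensitivity C x0 < #|I|.+1)%N by rewrite ltnS max_card.
rewrite /max_sensitivity (bigop.bigmax_eq_arg (Ordinal lt_r)) //; last first.
  by apply/asboolP; exists x0.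
case: arg_maxnP => [|r /asboolP //].
by apply/asboolP; exists x0.
Qed.

Definition block (n k : nat) (x : lattice ('I_n * 'I_k)%type) (i : 'I_n) :
    lattice 'I_k :=
  [ffun j => x (i, j)].

Definition repeated_coloring (n k : nat) (C : coloring ('I_n * 'I_k)%type) :
    Prop :=
  exists C' : coloring 'I_k,
    [/\ nontrivial C',
        red_sensitivity C' = 1%N
      & forall x, blue C x <-> exists i : 'I_n, blue C' (block x i)].

(* Main.v *)
(** The red points of a colouring with red sensitivity 1 force the blue set to be
closed under completing three points of a unit square, so every blue component
is a box, and a corner of the box through a blue point [x] is sensitive in every
direction [j] in which the box is bounded on at least one side ("bounded" below),
i.e. in which the line through [x] meets a red point.  Let [p i] be a blue point on the [i]-th axis.  The box of [p i] is
bounded in direction [i] because the origin is red, and for [i != j] the box of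
[p i] is bounded in direction [j] or that of [p j] in direction [i], since
otherwise both boxes would contain [p i + p j] and the component would contain the
origin.  Summing over all pairs, some box is bounded in at least [(k + 1) / 2]
directions.  A repeated colouring with [n] blocks has red sensitivity at least [n]
and blue sensitivity at least that of a single block. *)
Require Import Defs.
From mathcomp Require Import all_boot all_order all_algebra.
From mathcomp Require Import boolp zify.

Set Implicit Arguments.
Unset Strict Implicit.
Unset Printing Implicit Defensive.

Import Order.TTheory GRing.Theory Num.Theory.
Local Open Scope ring_scope.

(** * Signed unit steps and sensitive directions *)

Definition step (I : finType) (i : I) (b : bool) : {ffun I -> int} :=
  if b then unit_vec i else - unit_vec i.

Lemma stepN (I : finType) (i : I) (b : bool) : - step i b = step i (~~ b).
Proof. by case: b; rewrite /step /= ?opprK. Qed.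

Definition sensitive (I : finType) (C : coloring I) (x : {ffun I -> int})
    (i : I) : bool :=
  (C (x + unit_vec i) != C x) || (C (x - unit_vec i) != C x).

Lemma axis_sensitivityE (I : finType) (C : coloring I) (x : {ffun I -> int}) :
  axis_sensitivity C x = #|[set i | sensitive C x i]|.
Proof. by []. Qed.

Lemma sensitiveP (I : finType) (C : coloring I) (x : {ffun I -> int}) (i : I) :
  reflect (exists b, C (x + step i b) != C x) (sensitive C x i).
Proof.
apply: (iffP orP) => [[] h|[[]]]; first by exists true.
- by exists false.
- by left.
- by right.
Qed.

(** * Red points on axis-parallel lines and completion of unit squares *)

Definition line_meets_red (I : finType) (C : coloring I) (x : {ffun I -> int})
    (i : I) : Prop :=
  exists z : int, ~~ C (x + unit_vec i *~ z).

Lemma line_meets_red_shift (I : finType) (C : coloring I)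
    (x : {ffun I -> int}) (i : I) (z : int) :
  line_meets_red C x i -> line_meets_red C (x + unit_vec i *~ z) i.
Proof.
by case=> w red_w; exists (w - z); rewrite -addrA -mulrzDr [z + _]addrC subrK.
Qed.

Lemma line_meets_red_step (I : finType) (C : coloring I) (x : {ffun I -> int})
    (i : I) :
  line_meets_red C x i -> exists b t, ~~ C (x + step i b *+ t).
Proof.
case=> -[t|t] hz; first by exists true, t.
by exists false, t.+1; rewrite /step mulNrn.
Qed.

(** A red [x] with blue neighbours in two distinct directions would have axis-sensitivity at least
    2. *)
Lemma square_blue (I : finType) (C : coloring I) (i j : I) (b c : bool)
    (x : {ffun I -> int}) :
  (red_sensitivity C <= 1)%N ->
  i != j -> C (x + step i b) -> C (x + step j c) -> C x.
Proof.
move=> red_le1 neq_ij Ci Cj; apply/negPn/negP => redx.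
have := leq_trans (@max_sensitivity_ge _ C (red C) x redx) red_le1.
apply/negP; rewrite -ltnNge axis_sensitivityE.
have <- : #|[set i; j]| = 2%N by rewrite cards2 neq_ij.
apply/subset_leq_card/subsetP => l; rewrite !inE.
case/orP => /eqP ->; apply/sensitiveP.
  by exists b; rewrite Ci (negPf redx).
by exists c; rewrite Cj (negPf redx).
Qed.

Lemma square_blue_step (I : finType) (C : coloring I) (i j : I) (b c : bool)
    (x : {ffun I -> int}) :
  (red_sensitivity C <= 1)%N ->
  i != j -> C x -> C (x + step j c + step i b) -> C (x + step j c).
Proof.
move=> red_le1 neq_ij Cx Cxji.
apply: (square_blue (c := ~~ c) red_le1 neq_ij Cxji).
by rewrite -stepN addrK.
Qed.

(** If the line through [x + step i b] were entirely blue, completing squares one after another,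
    both ways from [x], would make the parallel line through [x] entirely blue too. *)
Lemma line_meets_red_move (I : finType) (C : coloring I) (i j : I) (b : bool)
    (x : {ffun I -> int}) :
  (red_sensitivity C <= 1)%N -> C x -> C (x + step i b) ->
  line_meets_red C x j -> line_meets_red C (x + step i b) j.
Proof.
move=> red_le1 Cx Cxi red_j.
have [eq_ij|neq_ij] := eqVneq i j.
  rewrite -eq_ij in red_j *.
  have -> : step i b = unit_vec i *~ (if b then 1 else -1).
    by case: (b); rewrite /step ?mulr1z ?mulrN1z.
  exact: line_meets_red_shift.
case: red_j => z; apply: contraNP => nred.
have blue_line w : C (x + step i b + unit_vec j *~ w).
  by apply/negPn/negP => h; apply: nred; exists w.
elim: z => [|t IHt|t IHt]; first by rewrite mulr0z addr0.
  have := blue_line t.+1; rewrite -!pmulrn mulrSr !addrA.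
  rewrite [X in C (X + _)]addrAC [X in C X]addrAC.
  exact: (@square_blue_step _ _ i j b true).
have := blue_line (- t.+1%:Z); rewrite !mulrNz -!pmulrn mulrSr !opprD !addrA.
rewrite [X in C (X + _)]addrAC [X in C X]addrAC.
apply: (@square_blue_step _ _ i j b false) => //.
by rewrite pmulrn -mulrNz.
Qed.

(** The red neighbour of [x] in direction [j] stays red when moved along [i], since otherwise
    completing the square would make it blue. *)
Lemma sensitive_move (I : finType) (C : coloring I) (i j : I) (b : bool)
    (x : {ffun I -> int}) :
  (red_sensitivity C <= 1)%N -> i != j -> C x -> C (x + step i b) ->
  sensitive C x j -> sensitive C (x + step i b) j.
Proof.
move=> red_le1 neq_ij Cx Cxi /sensitiveP[c]; rewrite Cx eqb_id => redj.
apply/sensitiveP; exists c; rewrite Cxi eqb_id; apply: contra redj.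
rewrite addrAC; exact: square_blue_step.
Qed.

(** * Walking to a corner of the blue box *)

Lemma walk_to_boundary (I : finType) (C : coloring I) (i : I) (b : bool)
    (Q : {ffun I -> int} -> Prop) (t : nat) (x : {ffun I -> int}) :
  (forall y, C y -> C (y + step i b) -> Q y -> Q (y + step i b)) ->
  C x -> Q x -> ~~ C (x + step i b *+ t) ->
  exists y, [/\ C y, Q y & sensitive C y i].
Proof.
move=> moveQ; elim: t x => [|t IHt] x Cx Qx; first by rewrite mulr0n addr0 Cx.
have [Cxi|redxi _] := boolP (C (x + step i b)).
  by rewrite mulrS addrA; apply: IHt => //; apply: moveQ.
(* The walk stops at the last blue point before a red one. *)
by exists x; split=> //; apply/sensitiveP; exists b; rewrite Cx eqb_id.
Qed.

(** Walk to the boundary in one direction after another. The walk in direction [i] keeps the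
    sensitivities already gained in the other directions. The middle clause strengthens the
    induction: it guarantees that the next walk also ends. *)
Lemma corner_of_blue (I : finType) (C : coloring I) (x : {ffun I -> int})
    (s : seq I) :
  (red_sensitivity C <= 1)%N -> C x -> uniq s ->
  {in s, forall j, line_meets_red C x j} ->
  exists y, [/\ C y, forall j, line_meets_red C x j -> line_meets_red C y j
              & {in s, forall j, sensitive C y j}].
Proof.
move=> red_le1 Cx; elim: s => [|i s IHs] /=; first by exists x.
case/andP=> notin_i uniq_s red_s.
have [|y [Cy redy sens_y]] := IHs uniq_s.
  by move=> j sj; apply: red_s; rewrite inE sj orbT.
have /redy/line_meets_red_step[b [t red_t]] := red_s i (mem_head i s).
pose Q z := (forall j, line_meets_red C x j -> line_meets_red C z j) /\
            {in s, forall j, sensitive C z j}.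
have [||z [Cz [redz sens_z] sens_i]] :=
    @walk_to_boundary _ C i b Q t y _ Cy _ red_t.
- move=> z Cz Czi [redz sens_z]; split=> j; first last.
    move=> sj; apply: sensitive_move (sens_z j sj) => //.
    by apply: contraNneq notin_i => ->.
  by move/redz; apply: line_meets_red_move.
- by split.
exists z; split=> // j; rewrite inE => /predU1P[->//|]; exact: sens_z.
Qed.

Lemma card_line_meets_red (I : finType) (C : coloring I)
    (x : {ffun I -> int}) :
  (red_sensitivity C <= 1)%N -> C x ->
  (#|[set j | `[< line_meets_red C x j >]]| <= blue_sensitivity C)%N.
Proof.
move=> red_le1 Cx; set A := [set j | _].
have [|y [Cy _ sens_y]] := corner_of_blue red_le1 Cx (enum_uniq A).
  by move=> j; rewrite mem_enum inE => /asboolP.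
apply: leq_trans (@max_sensitivity_ge _ C (blue C) y Cy); rewrite axis_sensitivityE.
apply/subset_leq_card/subsetP => j Aj; rewrite inE.
by apply: sens_y; rewrite mem_enum.
Qed.

(** * Points on the axes and the double count *)

Lemma on_axisE (I : finType) (i : I) (x : {ffun I -> int}) :
  on_axis i x -> x = unit_vec i *~ x i.
Proof.
move=> axis_x; apply/ffunP => j.
have -> : (unit_vec i *~ x i) j = (unit_vec i j) *~ x i.
  case: (x i) => t; first by rewrite -!pmulrn ffunMnE.
  by rewrite NegzE !mulrNz -!pmulrn ffunE ffunMnE.
rewrite ffunE; case: eqP => [->|/eqP/axis_x ->]; last by rewrite mul0rz.
by rewrite intz.
Qed.

Lemma line_meets_red_own_axis (I : finType) (C : coloring I) (i : I)
    (x : {ffun I -> int}) :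
  ~~ C 0 -> on_axis i x -> line_meets_red C x i.
Proof.
move=> red0 /on_axisE ->; rewrite -[_ *~ _]add0r; apply: line_meets_red_shift.
by exists 0; rewrite mulr0z addr0.
Qed.

Lemma line_meets_red_translate (I : finType) (C : coloring I) (i j : I)
    (x : {ffun I -> int}) (z : int) :
  (red_sensitivity C <= 1)%N -> ~ line_meets_red C x i ->
  line_meets_red C x j -> line_meets_red C (x + unit_vec i *~ z) j.
Proof.
move=> red_le1 nred red_j.
have blue_line w : C (x + unit_vec i *~ w).
  by apply/negPn/negP => h; apply: nred; exists w.
elim: z => [|t IHt|t IHt]; first by rewrite mulr0z addr0.
  have := blue_line t.+1; rewrite -!pmulrn mulrSr !addrA => Ct.
  by apply: (@line_meets_red_move _ _ i j true) => //; apply: (blue_line t).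
have := blue_line (- t.+1%:Z); rewrite !mulrNz -!pmulrn mulrSr !opprD !addrA.
rewrite pmulrn -mulrNz => Ct.
by apply: (@line_meets_red_move _ _ i j false) => //; apply: (blue_line (- t%:Z)).
Qed.

Lemma line_meets_red_other_axis (I : finType) (C : coloring I) (i j : I)
    (x y : {ffun I -> int}) :
  (red_sensitivity C <= 1)%N -> ~~ C 0 -> on_axis i x -> on_axis j y ->
  line_meets_red C x j \/ line_meets_red C y i.
Proof.
move=> red_le1 red0 axis_x axis_y.
have [|nred] := EM (line_meets_red C y i); [by right | left].
(* The line through [y] in direction [i] is blue, so the red point on the [j]-line of [y] yields one
   on the [j]-line of [y + x], which is also the [j]-line of [x]. *)
have := line_meets_red_translate (x i) red_le1 nred
          (line_meets_red_own_axis red0 axis_y).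
rewrite -on_axisE // => /(@line_meets_red_shift _ _ _ _ (- y j)).
by rewrite mulrNz -on_axisE // addrAC subrr add0r.
Qed.

Lemma card_le_blue_sensitivity (I : finType) (C : coloring I) :
  nontrivial C -> (red_sensitivity C <= 1)%N -> (0 < #|I|)%N ->
  (#|I|.+1 <= 2 * blue_sensitivity C)%N.
Proof.
case=> red0 /choice[p p_axis] red_le1 I_gt0.
pose r i j : nat := `[< line_meets_red C (p i) j >].
have sum_r i : (\sum_j r i j <= blue_sensitivity C)%N.
  have [_ Cp] := p_axis i.
  apply: leq_trans (card_line_meets_red red_le1 Cp).
  rewrite -sum1dep_card [leqRHS]big_mkcond; apply: leq_sum => j _.
  by rewrite /r; case: asboolP.
(* On the diagonal the bound is 2, because [r i i] is counted twice; this makes each row sum at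
   least [#|I|.+1] instead of [#|I|]. *)
have r_ge i j : ((i == j).+1 <= r i j + r j i)%N.
  have [[axis_i _] [axis_j _]] := (p_axis i, p_axis j); rewrite /r.
  have [<-|_] := eqVneq i j.
    by rewrite asboolT //; apply: line_meets_red_own_axis.
  have [h|h] := line_meets_red_other_axis red_le1 red0 axis_i axis_j.
    by rewrite [`[< line_meets_red C (p i) j >]]asboolT.
  by rewrite [`[< line_meets_red C (p j) i >]]asboolT // addn1.
have ub : (\sum_i \sum_j r i j <= #|I| * blue_sensitivity C)%N.
  by rewrite -sum_nat_const leq_sum.
have lb : (#|I| * #|I|.+1 <= \sum_i \sum_j (r i j + r j i))%N.
  rewrite -sum_nat_const leq_sum // => i _.
  apply: leq_trans (leq_sum _ (fun j _ => r_ge i j)).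
  under eq_bigr do rewrite -addn1.
  rewrite big_split /= sum1_card addnC -addn1 leq_add2l (bigD1 i) //= eqxx //.
have double : (\sum_i \sum_j (r i j + r j i) = 2 * \sum_i \sum_j r i j)%N.
  under eq_bigr do rewrite big_split.
  by rewrite big_split /= [X in (_ + X)%N]exchange_big addnn mul2n.
rewrite -(leq_pmul2l I_gt0); apply: leq_trans lb _.
by rewrite double mulnCA leq_pmul2l.
Qed.

(** * From a single block to the repeated coloring *)

Lemma repeatedE (n k : nat) (C : coloring ('I_n * 'I_k)%type)
    (C' : coloring 'I_k) (x : {ffun 'I_n * 'I_k -> int}) (i : 'I_n) :
  (forall x, blue C x <-> exists i, blue C' (block x i)) ->
  (forall l, l != i -> ~~ C' (block x l)) -> C x = C' (block x i).
Proof.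
move=> CE red_x; apply/idP/idP => [/CE[l]|Ci]; last by apply/CE; exists i.
by have [->|/red_x/negPf] := eqVneq l i; rewrite /blue => // ->.
Qed.

Lemma block_step (n k : nat) (x : {ffun 'I_n * 'I_k -> int}) (i l : 'I_n)
    (j : 'I_k) (b : bool) :
  block (x + step (i, j) b) l = if l == i then block x l + step j b else block x l.
Proof.
apply/ffunP => m; rewrite /step; case: b; rewrite !ffunE;
  have [->|neq_li] := eqVneq l i; rewrite !ffunE xpair_eqE ?eqxx ?(negPf neq_li) //=;
  by rewrite ?oppr0 addr0.
Qed.

(** A step in direction [(i, j)] changes block [i] only, so the other blocks stay red and [C] keeps
    following [C'] on block [i]. *)
Lemma repeated_sensitive (n k : nat) (C : coloring ('I_n * 'I_k)%type)
    (C' : coloring 'I_k) (x : {ffun 'I_n * 'I_k -> int}) (i : 'I_n) (j : 'I_k) :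
  (forall x, blue C x <-> exists i, blue C' (block x i)) ->
  (forall l, l != i -> ~~ C' (block x l)) ->
  sensitive C' (block x i) j -> sensitive C x (i, j).
Proof.
move=> CE red_x /sensitiveP[b sens]; apply/sensitiveP; exists b.
rewrite (repeatedE CE red_x) (@repeatedE _ _ _ _ _ i CE).
  by rewrite block_step eqxx.
by move=> l neq_li; rewrite block_step (negPf neq_li) red_x.
Qed.

Lemma repeated_red_sensitivity (n k : nat) (C : coloring ('I_n * 'I_k)%type)
    (C' : coloring 'I_k) :
  (forall x, blue C x <-> exists i, blue C' (block x i)) ->
  ~~ C' 0 -> (0 < red_sensitivity C')%N -> (n <= red_sensitivity C)%N.
Proof.
move=> CE red0.
have [y [redy]] := @max_sensitivity_attained _ C' (red C') 0 red0.
rewrite -/(red_sensitivity C') => <-.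
rewrite axis_sensitivityE => /card_gt0P[j]; rewrite inE => sens_j.
(* With the red point [y] copied into every block, each of the [n] directions [(i, j)] is
   sensitive. *)
pose x : {ffun 'I_n * 'I_k -> int} := [ffun p => y p.2].
have blockx i : block x i = y by apply/ffunP => m; rewrite !ffunE.
have redx : red C x by apply/negP => /CE[i]; rewrite blockx; apply/negP.
apply: leq_trans (@max_sensitivity_ge _ C (red C) x redx); rewrite axis_sensitivityE.
have inj_j : injective (fun i : 'I_n => (i, j)) by move=> ? ? [].
rewrite -{1}[n]card_ord -cardsT -(card_imset _ inj_j).
apply/subset_leq_card/subsetP => _ /imsetP[i _ ->]; rewrite inE.
by apply: (repeated_sensitive CE) => [l _|]; rewrite blockx.
Qed.

Lemma repeated_blue_sensitivity (n k : nat) (C : coloring ('I_n * 'I_k)%type)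
    (C' : coloring 'I_k) :
  (forall x, blue C x <-> exists i, blue C' (block x i)) ->
  ~~ C' 0 -> (0 < n)%N -> (exists y, blue C' y) ->
  (blue_sensitivity C' <= blue_sensitivity C)%N.
Proof.
move=> CE red0 n_gt0 [y0 bluey0].
have [y [bluey]] := @max_sensitivity_attained _ C' (blue C') y0 bluey0.
rewrite -/(blue_sensitivity C') => <-.
pose i0 := Ordinal n_gt0.
(* All blocks other than [i0] sit at the red origin, so the color near [x] is decided by block
   [i0]. *)
pose x : {ffun 'I_n * 'I_k -> int} := [ffun p => if p.1 == i0 then y p.2 else 0].
have block0 : block x i0 = y by apply/ffunP => m; rewrite !ffunE eqxx.
have red_x l : l != i0 -> ~~ C' (block x l).
  move=> /negPf neq; suff -> : block x l = 0 by [].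
  by apply/ffunP => m; rewrite !ffunE /= neq.
have bluex : blue C x by apply/CE; exists i0; rewrite block0.
apply: leq_trans (@max_sensitivity_ge _ C (blue C) x bluex).
rewrite !axis_sensitivityE.
have inj_i : injective (fun j : 'I_k => (i0, j)) by move=> ? ? [].
rewrite -(card_imset _ inj_i).
apply/subset_leq_card/subsetP => _ /imsetP[j + ->]; rewrite !inE => sens_j.
by apply: (repeated_sensitive CE) => //; rewrite block0.
Qed.

Theorem theorem7 (n k d : nat) (C : coloring ('I_n * 'I_k)%type)
    (hd : d = (n * k)%N) (hC : repeated_coloring C) :
  (d%:Z <= (red_sensitivity C)%:Z * (2 * (blue_sensitivity C)%:Z - 1))%R.
Proof.
case: hC => C' [nontriv red1 CE]; have [red0 axes] := nontriv.
(* In dimension 0 every axis-sensitivity is 0, against [red1]. *)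
have k_gt0 : (0 < k)%N.
  have [y [_ sens_y]] := @max_sensitivity_attained _ C' (red C') 0 red0.
  by rewrite -[k]card_ord -red1 /red_sensitivity -sens_y max_card.
have := repeated_red_sensitivity CE red0; rewrite red1 => /(_ isT) n_le.
have [n0|n_gt0] := posnP n.
  (* The second factor may be negative here, so the first one has to vanish. *)
  suff -> : red_sensitivity C = 0%N by rewrite mul0r hd {1}n0.
  apply/eqP; rewrite -leqn0; apply/bigmax_leqP => r _.
  by rewrite -ltnS (leq_trans (ltn_ord r)) // card_prod card_ord n0.
have blue_ex : exists y, blue C' y.
  by have [y [_ bluey]] := axes (Ordinal k_gt0); exists y.
have b_le := repeated_blue_sensitivity CE red0 n_gt0 blue_ex.
have := card_le_blue_sensitivity nontriv; rewrite red1 card_ord => /(_ isT k_gt0).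
move=> k_lt; rewrite hd.
(* By [k_lt] and [b_le] the blue sensitivity is positive, so this natural subtraction agrees with
   the integer one in the goal. *)
have k_le : (k <= 2 * blue_sensitivity C - 1)%N by lia.
have := leq_mul n_le k_le; nia.
Qed.
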